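(* Let $(\mathcal{X},c)$ be a metric space with diameter at most $1$, and let $p\ge 1$ and $k\ge 0$. Then $\mathrm{RPW}_{p,k}(\cdot,\cdot)$ is a metric on the set of Borel probability distributions on $\mathcal{X}$. That is, for all probability distributions $\mu,\nu,\kappa$ on $\mathcal{X}$: (i) $\mathrm{RPW}_{p,k}(\mu,\mu)=0$; (ii) $\mathrm{RPW}_{p,k}(\mu,\nu)>0$ whenever $\mu\neq\nu$; (iii) $\mathrm{RPW}_{p,k}(\mu,\nu)=\mathrm{RPW}_{p,k}(\nu,\mu)$; (iv) $\mathrm{RPW}_{p,k}(\mu,\nu)\le \mathrm{RPW}_{p,k}(\mu,\kappa)+\mathrm{RPW}_{p,k}(\kappa,\nu)$.
   Context: $(\mathcal{X},c)$ is a (compact) metric space with $c(x,y)\le 1$ for all $x,y\in\mathcal{X}$; distributions are Borel probability measures on $\mathcal{X}$. For $p\in[1,\infty)$, $\alpha\in[0,1]$ and probability distributions $\mu,\nu$, a partial transport plan of mass $\alpha$ is a nonnegative Borel measure $\gamma$ on $\mathcal{X}\times\mathcal{X}$ of total mass $\alpha$ whose first marginal is dominated by $\mu$ and whose second marginal is dominated by $\nu$ (setwise). Its cost is $w_p(\gamma)=\left(\int c(x,y)^p\,d\gamma(x,y)\right)^{1/p}$. The $\alpha$-partial $p$-Wasserstein distance is $W_{p,\alpha}(\mu,\nu)=\inf w_p(\gamma)$ over all partial transport plans of mass $\alpha$; for $\alpha=1$ this is the $p$-Wasserstein distance $W_p(\mu,\nu)$. For $k\ge 0$, the $(p,k)$-RPW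 distance is $\mathrm{RPW}_{p,k}(\mu,\nu)=\inf\{\varepsilon\in[0,1] : W_{p,1-\varepsilon}(\mu,\nu)\le k\varepsilon\}$. *)

(* Defs.v *)
From HB Require Import structures.
From mathcomp Require Import all_boot all_order all_algebra.
From mathcomp Require Import all_classical all_reals all_analysis.
Set Implicit Arguments. Unset Strict Implicit. Unset Printing Implicit Defensive.
Import Order.TTheory GRing.Theory Num.Theory.
Local Open Scope classical_set_scope.
Local Open Scope ring_scope.

Section RPW.
Context {R : realType} {d : measure_display} {T : measurableType d}.

Definition is_metric (c : T -> T -> R) : Prop :=
  [/\ forall x y, 0 <= c x y,
      forall x y, c x y = 0 <-> x = y,
      forall x y, c x y = c y x &
      forall x y z, c x z <= c x y + c y z].

Definition c_open (c : T -> T -> R) (A : set T) : Prop :=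
  forall x, A x -> exists2 r : R, 0 < r & [set y | c x y < r] `<=` A.

Definition is_borel (c : T -> T -> R) : Prop :=
  forall A : set T, measurable A <-> <<s c_open c >> A.

Definition c_compact (c : T -> T -> R) : Prop :=
  forall (I : Type) (U : I -> set T), (forall i, c_open c (U i)) ->
    (forall x, exists i, U i x) ->
    exists (n : nat) (f : 'I_n -> I), forall x, exists j, U (f j) x.

Definition partial_plan (mu nu : set T -> \bar R) (alpha : R)
    (g : {measure set (T * T)%type -> \bar R}) : Prop :=
  [/\ g setT = alpha%:E,
      forall A, measurable A -> g (A `*` setT) <= mu A &
      forall A, measurable A -> g (setT `*` A) <= nu A]%E.

Definition wcost (c : T -> T -> R) (p : R)
    (g : {measure set (T * T)%type -> \bar R}) : R :=
  (fine (\int[g]_z ((c z.1 z.2) `^ p)%:E)%E) `^ p^-1.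

Definition Wpa (c : T -> T -> R) (p alpha : R) (mu nu : set T -> \bar R) : \bar R :=
  ereal_inf [set (wcost c p g)%:E | g in partial_plan mu nu alpha].

Definition RPW (c : T -> T -> R) (p k : R) (mu nu : set T -> \bar R) : \bar R :=
  ereal_inf [set e%:E | e in [set e : R | 0 <= e <= 1 /\
                         (Wpa c p (1 - e) mu nu <= (k * e)%:E)%E]].

End RPW.

(* Main.v *)
(** The triangle inequality rests on gluing a plan of mass [1 - e1] from [mu] to
[kappa] with a plan of mass [1 - e2] from [kappa] to [nu]. Disintegration is
avoided by gluing only approximately: compactness yields a finite Borel
partition [B_i] of diameter less than [r], and
[sum_i kappa(B_i)^-1 (g1 x g2)] restricted to [{((x, y), (y', z)) | y, y' in B_i}]
has marginals dominated by [g1] and [g2], and mass at least [1 - e1 - e2].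
Minkowski's inequality applied to [c x z <= c x y + c y y' + c y' z] bounds the
cost of the glued plan by the sum of the two costs plus [r].

For definiteness, a plan of mass [1 - e] and cost [w] satisfies
[mu A <= nu (A_r) + e + w / r] where [A_r] is the open [r]-neighbourhood of [A];
if the distance is zero then [mu A <= nu A] for every closed [A], and the two
measures agree by symmetry and a pi-lambda argument. *)

Require Import Defs.
From HB Require Import structures.
From mathcomp Require Import all_boot all_order all_algebra.
From mathcomp Require Import all_classical all_reals all_analysis.
From mathcomp Require Import measurable_realfun lra.
Import Order.TTheory GRing.Theory Num.Theory.
Local Open Scope classical_set_scope.
Local Open Scope ring_scope.

Set Implicit Arguments.
Unset Strict Implicit.

(** * Measurability of the metric and finite Borel partitions of small diameter *)

Lemma measurable_fun_sublevel (R : realType) (d : measure_display)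
    (T : measurableType d) (f : T -> R) :
  (forall r, measurable [set x | f x < r]) -> measurable_fun [set: T] f.
Proof.
move=> mf; apply: (measurability _ (RGenInftyO.measurableE R)) => _ [_ [r ->] <-].
rewrite setTI [X in measurable X](_ : _ = [set x | f x < r])//.
Qed.

Section compact_metric.
Context {R : realType} {d : measure_display} {T : measurableType d}.
Variable c : T -> T -> R.
Hypotheses (c_metric : is_metric c) (c_borel : is_borel c).

Lemma c_ge0 x y : 0 <= c x y.
Proof. by case: c_metric. Qed.

Lemma c_refl x : c x x = 0.
Proof. by case: c_metric => _ c0 _ _; apply/c0. Qed.

Lemma c_sym x y : c x y = c y x.
Proof. by case: c_metric. Qed.

Lemma c_triangle x y z : c x z <= c x y + c y z.
Proof. by case: c_metric. Qed.

Lemma c_open_measurable A : c_open c A -> measurable A.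
Proof. by move=> oA; apply/c_borel; exact: sub_sigma_algebra. Qed.

Lemma c_open_ball x r : c_open c [set y | c x y < r].
Proof.
move=> y /= xyr; exists (r - c x y); first by rewrite subr_gt0.
move=> z /= yz; apply: le_lt_trans (c_triangle x y z) _; lra.
Qed.

Lemma c_open_bigcup (I : Type) (D : set I) (F : I -> set T) :
  (forall i, D i -> c_open c (F i)) -> c_open c (\bigcup_(i in D) F i).
Proof.
move=> oF x [i Di Fix]; have [r r0 rF] := oF i Di x Fix.
by exists r => // y /rF Fiy; exists i.
Qed.

Lemma c_openI A B : c_open c A -> c_open c B -> c_open c (A `&` B).
Proof.
move=> oA oB x [/oA[r r0 rA] /oB[s s0 sB]].
exists (Num.min r s) => [|y /=]; first by rewrite lt_min r0.
by rewrite lt_min => /andP[/rA ? /sB].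
Qed.

Lemma measurable_c_ball x r : measurable [set y | c x y < r].
Proof. exact/c_open_measurable/c_open_ball. Qed.

Lemma measurable_c x : measurable_fun [set: T] (c x).
Proof. by apply: measurable_fun_sublevel => r; exact: measurable_c_ball. Qed.

Hypothesis c_cpt : c_compact c.

Lemma finite_c_net (r : R) : 0 < r ->
  exists (n : nat) (f : 'I_n -> T), forall x, exists j, c (f j) x < r.
Proof.
move=> r0; apply: (@c_cpt T (fun x => [set y | c x y < r])).
- by move=> x; exact: c_open_ball.
- by move=> x; exists x; rewrite /= c_refl.
Qed.

(** The product of the Borel sigma-algebras need not be handed all open subsets of the product, so
    each sublevel set is written as a countable union, over the centres of finite nets of mesh
    [1/(m+1)], of sets defined by one-variable distances to a fixed centre. *)
Lemma measurable_c_pair :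
  measurable_fun [set: T * T] (fun z : T * T => c z.1 z.2).
Proof.
apply: measurable_fun_sublevel => r.
have /choice[s sP] m : exists s : {n : nat & 'I_n -> T},
    forall x, exists j, c (projT2 s j) x < m.+1%:R^-1.
  have [|n [f fm]] := @finite_c_net m.+1%:R^-1; first by rewrite invr_gt0.
  by exists (existT _ n f).
pose F m := projT2 (s m).
have -> : [set z : T * T | c z.1 z.2 < r] =
    \bigcup_m \bigcup_j [set z : T * T | c (F m j) z.1 + c (F m j) z.2 < r].
  apply/seteqP; split => [[x y] /= xyr|[x y] [m _ [j _ /=]]]; last first.
    by move=> h; apply: le_lt_trans (c_triangle x (F m j) y) _; rewrite (c_sym x).
  (* A centre [q] closer to [x] than this satisfies [c q x + c q y <= 2 c q x + c x y < r]. *)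
  have e0 : 0 < (r - c x y) / 2 by rewrite divr_gt0// subr_gt0.
  have [m /= mr] := ltr_add_invr e0.
  have [j jx] : exists j, c (F m j) x < m.+1%:R^-1 := sP m x.
  exists m => //; exists j => //=.
  have := c_triangle (F m j) x y; rewrite add0r in mr; have {mr} := lt_trans jx mr; lra.
apply: bigcupT_measurable => m.
apply: fin_bigcup_measurable => // j _.
rewrite -[X in measurable X]setTI.
have -> : [set z : T * T | c (F m j) z.1 + c (F m j) z.2 < r] =
    (fun z : T * T => c (F m j) z.1 + c (F m j) z.2) @^-1` `]-oo, r[.
  by apply/seteqP; split => x /=; rewrite in_itv.
apply: measurable_funD => //.
- exact: (measurableT_comp (measurable_c _) measurable_fst).
- exact: (measurableT_comp (measurable_c _) measurable_snd).
Qed.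

(** The balls of radius [r / 2] around a finite net are made disjoint by removing from each the
    earlier ones. *)
Lemma finite_c_partition (r : R) : 0 < r ->
  exists (n : nat) (B : nat -> set T),
  [/\ forall i, measurable (B i), trivIset setT B,
      \big[setU/set0]_(i < n) B i = setT &
      forall i x y, B i x -> B i y -> c x y < r].
Proof.
move=> r0; have r20 : 0 < r / 2 by rewrite divr_gt0.
have [n [f fr]] := finite_c_net r20.
(* The finite family is extended by empty sets to all of [nat], the index type of [seqDU]. *)
pose B i := oapp (fun j => [set y | c (f j) y < r / 2]) set0 (insub i).
have mB i : measurable (B i).
  by rewrite /B; case: insubP => //= j _ _; exact: measurable_c_ball.
exists n, (seqDU B); split => [||| i x y].
- exact: seqDU_measurable.
- exact: trivIset_seqDU.
- rewrite -bigsetU_seqDU; apply/seteqP; split=> // x _.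
  have [j jx] := fr x.
  by rewrite -bigcup_mkord; exists j => //=; rewrite /B valK.
move=> Bx By; move: (@subset_seqDU _ B i x Bx) (@subset_seqDU _ B i y By).
rewrite /B; case: insubP => //= j _ _.
move=> jx jy; have := c_triangle x (f j) y; rewrite (c_sym x (f j)); lra.
Qed.

End compact_metric.

(** * Monotonicity of L^p norms and push-forwards *)

Section Lnorm_extra.
Context {R : realType} {d : measure_display} {T : measurableType d}.
Local Open Scope ereal_scope.

Lemma ge0_LnormE (m : {measure set T -> \bar R}) (p : R) (f : T -> R) :
  (forall x, (0 <= f x)%R) ->
  Lnorm m p%:E (EFin \o f) = (\int[m]_x (f x `^ p)%:E) `^ p^-1.
Proof.
move=> f0; rewrite Lnorm.unlock; congr poweR.
by apply: eq_integral => x _ /=; rewrite ger0_norm.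
Qed.

Lemma measurable_EFin_powR (f : T -> R) (p : R) :
  measurable_fun [set: T] f ->
  measurable_fun [set: T] (fun x => (f x `^ p)%:E).
Proof.
by move=> mf; apply/measurable_EFinP; exact: measurableT_comp (measurable_powR p) mf.
Qed.

Lemma poweR_le_homo (p : R) (a b : \bar R) : (0 <= p)%R ->
  0 <= a -> a <= b -> a `^ p <= b `^ p.
Proof.
move=> p0 a0 ab; apply: gt0_ler_poweR => //; rewrite in_itv/= ?a0 ?leey//.
by rewrite (le_trans a0 ab).
Qed.

(** An almost everywhere hypothesis is what gluing provides: the two middle points are close only
    off a null set. *)
Lemma ae_le_Lnorm (m : {measure set T -> \bar R}) (p : R) (f g : T -> R) :
  (0 <= p)%R -> (forall x, (0 <= f x)%R) -> (forall x, (0 <= g x)%R) ->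
  measurable_fun [set: T] f -> measurable_fun [set: T] g ->
  {ae m, forall x, (f x <= g x)%R} ->
  Lnorm m p%:E (EFin \o f) <= Lnorm m p%:E (EFin \o g).
Proof.
move=> p0 f0 g0 mf mg fg; rewrite !ge0_LnormE//.
apply: poweR_le_homo; first by rewrite invr_ge0.
  by apply: integral_ge0 => x _; rewrite lee_fin powR_ge0.
apply: ae_ge0_le_integral => //.
- by move=> x _; rewrite lee_fin powR_ge0.
- exact: measurable_EFin_powR.
- by move=> x _; rewrite lee_fin powR_ge0.
- exact: measurable_EFin_powR.
by apply: filterS fg => x fgx _; rewrite lee_fin ge0_ler_powR// nnegrE.
Qed.

Lemma Lnorm_cst_le (m : {measure set T -> \bar R}) (p a : R) :
  (0 < p)%R -> (0 <= a)%R -> m setT <= 1 ->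
  Lnorm m p%:E (EFin \o cst a) <= a%:E.
Proof.
move=> p0 a0 m1; rewrite ge0_LnormE//.
(* Writing [a] as a p-th root reduces the claim to [a^p m(T) <= a^p]. *)
rewrite (_ : a%:E = (a `^ p)%:E `^ p^-1); last first.
  by rewrite poweR_EFin -powRrM mulfV ?gt_eqF// powRr1.
apply: poweR_le_homo; first by rewrite invr_ge0 ltW.
  by apply: integral_ge0 => x _; rewrite lee_fin powR_ge0.
rewrite [leLHS](integral_cst m measurableT (a `^ p)%:E) -[leRHS]mule1.
by apply: lee_wpmul2l => //; rewrite lee_fin powR_ge0.
Qed.

End Lnorm_extra.

(** The measure structure on a push-forward depends on the proof [mphi], so the instance is named
    explicitly. *)
Definition push_measure (R : realType) (d d' : measure_display)
    (T : measurableType d) (T' : measurableType d')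
    (m : {measure set T -> \bar R}) (phi : T -> T')
    (mphi : measurable_fun [set: T] phi) : {measure set T' -> \bar R} :=
  measure_function_pushforward__canonical__measure_function_Measure m mphi.

Section Lnorm_pushforward.
Context {R : realType} {d d' : measure_display}.
Context {T : measurableType d} {T' : measurableType d'}.
Local Open Scope ereal_scope.

(** Change of variables, then monotonicity of the integral in the measure. Domination is assumed
    instead of equality because the marginals of a glued measure are only dominated by the given
    plans. *)
Lemma le_Lnorm_pushforward
    (m : {measure set T -> \bar R}) (m' : {measure set T' -> \bar R})
    (phi : T -> T') (p : R) (f : T' -> R) :
  measurable_fun [set: T] phi ->
  (forall A, measurable A -> m (phi @^-1` A) <= m' A) ->
  (0 <= p)%R -> (forall x, (0 <= f x)%R) -> measurable_fun [set: T'] f ->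
  Lnorm m p%:E (EFin \o (f \o phi)) <= Lnorm m' p%:E (EFin \o f).
Proof.
move=> mphi mm' p0 f0 mf; rewrite !ge0_LnormE//; first last.
  by move=> x; exact: f0.
apply: poweR_le_homo; first by rewrite invr_ge0.
  by apply: integral_ge0 => x _; rewrite lee_fin powR_ge0.
have mfp := measurable_EFin_powR p mf.
apply: (@le_trans _ _ (\int[push_measure m mphi]_y (f y `^ p)%:E)).
  rewrite (ge0_integral_pushforward mphi m measurableT mfp)//.
  by move=> y _; rewrite lee_fin powR_ge0.
by apply: ge0_le_measure_integral => // y; rewrite lee_fin powR_ge0.
Qed.

Lemma Lnorm_pushforward
    (m : {measure set T -> \bar R}) (phi : T -> T') (p : R) (f : T' -> R)
    (mphi : measurable_fun [set: T] phi) :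
  (forall x, (0 <= f x)%R) -> measurable_fun [set: T'] f ->
  Lnorm (push_measure m mphi) p%:E (EFin \o f) =
  Lnorm m p%:E (EFin \o (f \o phi)).
Proof.
move=> f0 mf; rewrite !ge0_LnormE//; first last.
  by move=> x; exact: f0.
congr poweR; have mfp := measurable_EFin_powR p mf.
rewrite (ge0_integral_pushforward mphi m measurableT mfp)//.
by move=> y _; rewrite lee_fin powR_ge0.
Qed.

End Lnorm_pushforward.

(** * Partial plans: cost, mass transported far, diagonal and swapped plans *)

Section plans.
Context {R : realType} {d : measure_display} {T : measurableType d}.
Variables (c : T -> T -> R) (p : R).
Hypotheses (c_metric : is_metric c) (c_borel : is_borel c).
Hypotheses (c_cpt : c_compact c) (c_le1 : forall x y, c x y <= 1).
Hypothesis p1 : 1 <= p.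
Implicit Types (g : {measure set (T * T)%type -> \bar R}).
Implicit Types (mu nu kappa : probability T R).

Let cz (z : T * T) := c z.1 z.2.

Let p0 : 0 < p.
Proof. exact: lt_le_trans p1. Qed.

Let mcz : measurable_fun [set: T * T] cz.
Proof. exact: measurable_c_pair. Qed.

Let measurable_superlevel r : measurable [set z : T * T | r <= c z.1 z.2].
Proof.
rewrite -[X in measurable X]setTI [X in _ `&` X](_ : _ = cz @^-1` `[r, +oo[).
  exact: mcz.
by apply/seteqP; split => z /=; rewrite in_itv/= andbT.
Qed.

Let cz0 z : 0 <= cz z.
Proof. exact: c_ge0. Qed.

Lemma integral_cost_le g :
  (\int[g]_z ((c z.1 z.2) `^ p)%:E <= g setT)%E.
Proof.
rewrite -[leRHS]mul1e -integral_cst//; apply: ge0_le_integral => //.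
- by move=> z _; rewrite lee_fin powR_ge0.
- exact: measurable_EFin_powR.
move=> z _; have : c z.1 z.2 `^ p <= 1 `^ p.
  by rewrite ge0_ler_powR ?nnegrE ?(ltW p0)//; exact: cz0.
by rewrite lee_fin powR1.
Qed.

(** Since [c <= 1], finite mass makes the integral finite, so [fine] loses nothing; costs thereby
    come under Minkowski's inequality. *)
Lemma wcost_Lnorm g : (g setT < +oo)%E ->
  (wcost c p g)%:E = Lnorm g p%:E (EFin \o cz).
Proof.
move=> goo; rewrite ge0_LnormE// /wcost -poweR_EFin fineK//.
rewrite ge0_fin_numE; first exact: le_lt_trans (integral_cost_le g) goo.
by apply: integral_ge0 => z _; rewrite lee_fin powR_ge0.
Qed.

Lemma wcost_ge0 g : 0 <= wcost c p g.
Proof. exact: powR_ge0. Qed.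

Lemma plan_lty (mu nu : set T -> \bar R) a g :
  partial_plan mu nu a g -> (g setT < +oo)%E.
Proof. by case=> -> _ _; rewrite ltry. Qed.

(** With [m] the mass of the set and [w] the cost, Markov's inequality gives [r^p m <= w^p], hence
    [r m^(1/p) <= w]. As [m <= 1] and [1/p <= 1], also [m <= m^(1/p)]. *)
Lemma wcost_markov g (r : R) : 0 < r -> (g setT <= 1)%E ->
  (g [set z | (r <= c z.1 z.2)%R] <= (wcost c p g / r)%:E)%E.
Proof.
move=> r0 g1.
set A := [set z | _].
have mA : measurable A by exact: measurable_superlevel.
have gA1 : (g A <= 1)%E by apply: le_trans g1; apply: le_measure; rewrite ?inE.
have gAfin : g A \is a fin_num.
  by rewrite ge0_fin_numE// (le_lt_trans gA1)// ltry.
have [m0|m0] := eqVneq (fine (g A)) 0.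
  by rewrite -(fineK gAfin) m0 lee_fin divr_ge0// ?wcost_ge0// ltW.
have {}m0 : 0 < fine (g A) by rewrite lt_neqAle eq_sym m0 fine_ge0.
have m1 : fine (g A) <= 1 by rewrite -lee_fin fineK.
rewrite -(fineK gAfin) lee_fin ler_pdivlMr//.
apply: (@le_trans _ _ ((r `^ p * fine (g A)) `^ p^-1)).
  rewrite powRM ?powR_ge0 ?(ltW m0)//.
  rewrite -powRrM mulfV ?gt_eqF// powRr1 ?(ltW r0)// mulrC.
  rewrite ler_pM2l//; apply: ger1_powR; first by rewrite m0.
  by rewrite invf_le1.
rewrite /wcost ge0_ler_powR ?invr_ge0 ?nnegrE ?(ltW p0)//.
- by rewrite mulr_ge0 ?powR_ge0// ltW.
- by apply: fine_ge0; apply: integral_ge0 => z _; rewrite lee_fin powR_ge0.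
have Ifin : (\int[g]_z ((c z.1 z.2) `^ p)%:E)%E \is a fin_num.
  rewrite ge0_fin_numE; first by rewrite (le_lt_trans (integral_cost_le g))// (le_lt_trans g1)// ltry.
  by apply: integral_ge0 => z _; rewrite lee_fin powR_ge0.
rewrite -lee_fin fineK// EFinM fineK//.
rewrite -[leRHS](_ : \int[g]_z `|((c z.1 z.2) `^ p)%:E| = _)%E; last first.
  by apply: eq_integral => z _; rewrite gee0_abs// lee_fin powR_ge0.
(* Markov's inequality for [c^p] at level [r^p]. *)
apply: le_trans (le_integral_abse _ measurableT _ (powR_gt0 p r0)); last first.
  exact: measurable_EFin_powR.
rewrite lee_wpmul2l ?lee_fin ?powR_ge0//.
apply: le_measure; rewrite ?inE//.
  apply: emeasurable_fun_c_infty => //; apply: measurableT_comp => //.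
  exact: measurable_EFin_powR.
move=> z /= rz; split => //; rewrite lee_fin ger0_norm ?powR_ge0//.
by rewrite ge0_ler_powR ?nnegrE ?(ltW p0) ?(ltW r0)//; exact: cz0.
Qed.


(** At most [e] of the mass of [A] is left untransported; the rest either lands in [B], where [nu]
    bounds it, or travels at least [r], where Markov's inequality bounds it. *)
Lemma plan_separated_sets mu nu e g (A B : set T) (r : R) :
  0 < r -> 0 <= e <= 1 -> partial_plan mu nu (1 - e) g ->
  measurable A -> measurable B ->
  (forall x y, A x -> ~ B y -> r <= c x y) ->
  (mu A <= nu B + (e + wcost c p g / r)%:E)%E.
Proof.
move=> r0 /andP[e0 e1] [gT g1 g2] mA mB AB.
have gT1 : (g setT <= 1)%E by rewrite gT lee_fin gerBl.
have gfin C : measurable C -> g C \is a fin_num.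
  move=> mC; rewrite ge0_fin_numE//; apply: le_lt_trans (ltry 1).
  by apply: le_trans gT1; apply: le_measure; rewrite ?inE.
have mAT : measurable (A `*` [set: T]) by exact: measurableX.
have mTB : measurable ([set: T] `*` B) by exact: measurableX.
have mACT : measurable (~` A `*` [set: T]).
  by apply: measurableX => //; exact: measurableC.
(* Domination is used on the complement [A'] of [A]: [1 - e = g(A x T) + g(A' x T) <= g(A x T) + 1 -
   mu A]. *)
have muA : (mu A <= g (A `*` setT) + e%:E)%E.
  have gTE : g setT = (g (A `*` setT) + g (~` A `*` setT))%E.
    rewrite -measureU//.
      congr (g _); apply/seteqP; split => // -[x y] _ /=.
      by have [|] := pselect (A x); [left|right].
    by apply/seteqP; split => // -[x y] /= [[]] ? _ [].
  have := g1 _ (measurableC mA).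
  rewrite probability_setC// -(fineK (fin_num_measure mu _ mA)).
  move: gTE; rewrite gT -(fineK (gfin _ mAT)) -(fineK (gfin _ mACT)).
  rewrite -!EFinD => -[gE]; rewrite !lee_fin => ?; lra.
have mC := measurable_superlevel r.
apply: (le_trans muA).
have : (g (A `*` setT) <= nu B + (wcost c p g / r)%:E)%E.
  apply: (@le_trans _ _
    (g (setT `*` B) + g [set z | (r <= c z.1 z.2)%R])%E); last first.
    by apply: leeD; [exact: g2|exact: wcost_markov].
  apply: le_trans (measureU2 _ _ _) => //; apply: le_measure; rewrite ?inE//.
    exact: measurableU.
  move=> [x y] /= [Ax _]; have [By|nBy] := pselect (B y); first by left.
  by right; exact: AB.
move=> /(leeD2r e%:E)/le_trans; apply.
by rewrite -addeA -EFinD (addrC (_ / r)).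
Qed.

Lemma diagonal_plan mu :
  partial_plan mu mu 1
    (push_measure mu (measurable_fun_pair (@measurable_id _ T setT)
                                          (@measurable_id _ T setT))).
Proof.
rewrite /partial_plan /push_measure /= /pushforward; split.
- by rewrite preimage_setT probability_setT.
- by move=> A mA; rewrite [X in mu X](_ : _ = A)//; apply/seteqP; split => // x [].
- by move=> A mA; rewrite [X in mu X](_ : _ = A)//; apply/seteqP; split => // x [].
Qed.

Lemma wcost_diagonal mu :
  wcost c p (push_measure mu (measurable_fun_pair (@measurable_id _ T setT)
                                          (@measurable_id _ T setT))) = 0.
Proof.
apply: EFin_inj; rewrite wcost_Lnorm; last first.
  by case: (diagonal_plan mu) => -> _ _; rewrite ltry.
rewrite Lnorm_pushforward//.
rewrite (@eq_Lnorm _ _ _ _ _ _ (cst 0%E)) ?Lnorm0 ?eqe ?gt_eqF//.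
by move=> x /=; rewrite /cz/= c_refl.
Qed.

(** Swapping the coordinates turns a plan into a reversed plan of the same cost. The other
    inequality is the same statement with [mu] and [nu] exchanged. *)
Lemma Wpa_sym_le (a : R) (mu nu : set T -> \bar R) :
  (Wpa c p a nu mu <= Wpa c p a mu nu)%E.
Proof.
apply: le_ereal_inf_tmp => _ [g gp <-].
have ms : measurable_fun [set: T * T] (fun z : T * T => (z.2, z.1))
  by apply: measurable_fun_pair.
have sp : partial_plan nu mu a (push_measure g ms).
  case: gp => gT g1 g2; rewrite /partial_plan /push_measure /= /pushforward; split.
  - by rewrite preimage_setT.
  - move=> A mA; apply: le_trans (g2 A mA); rewrite le_eqVlt; apply/orP; left.
    by apply/eqP; congr (g _); apply/seteqP; split => -[x y] /= [].
  - move=> A mA; apply: le_trans (g1 A mA); rewrite le_eqVlt; apply/orP; left.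
    by apply/eqP; congr (g _); apply/seteqP; split => -[x y] /= [].
apply: ge_ereal_inf; exists (wcost c p (push_measure g ms))%:E.
  by exists (push_measure g ms).
rewrite (wcost_Lnorm (plan_lty sp)) (wcost_Lnorm (plan_lty gp)).
rewrite Lnorm_pushforward//.
rewrite le_eqVlt; apply/orP; left; apply/eqP; apply: eq_Lnorm => -[x y] /=.
by rewrite /cz/= c_sym.
Qed.

Lemma Wpa_sym (a : R) (mu nu : set T -> \bar R) :
  Wpa c p a nu mu = Wpa c p a mu nu.
Proof. by apply/eqP; rewrite eq_le !Wpa_sym_le. Qed.

End plans.

(** * Gluing two finite measures along a finite partition *)

Lemma finite_measure_of (R : realType) (d : measure_display)
    (T : measurableType d) (m : {measure set T -> \bar R}) :
  (m setT < +oo)%E ->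
  exists m' : {finite_measure set T -> \bar R}, m = m' :> {measure set T -> \bar R}.
Proof.
move=> moo; have mfin : fin_num_fun m by exact: lty_fin_num_fun.
have msigma : sigma_finite setT m.
  by apply: fin_num_fun_sigma_finite; rewrite ?measure0.
pose H1 := isFinite.Build _ _ _ _ mfin.
pose H2 := isSFinite.Build _ _ _ _ (sfinite_measure_sigma_finite msigma).
pose H3 := isSigmaFinite.Build _ _ _ _ msigma.
pose m' := HB.pack_for (FiniteMeasure.type T R) (Measure.sort m) H1 H2 H3.
by exists m'; exact: eq_measure.
Qed.

Lemma measure_partition (R : realType) (d : measure_display)
    (T : measurableType d) (m : {measure set T -> \bar R}) (n : nat)
    (F : nat -> set T) (A : set T) :
  (forall i, measurable (F i)) -> trivIset setT F ->
  \big[setU/set0]_(i < n) F i = setT -> measurable A ->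
  m A = (\sum_(i < n) m (A `&` F i))%E.
Proof.
move=> mF tF FT mA; rewrite -{1}(setIT A) -FT big_distrr/=.
rewrite (@measure_bigsetU _ _ _ m (fun i => A `&` F i))//.
- by move=> i; exact: measurableI.
- exact: trivIset_setIl.
Qed.

Section gluing.
Context {R : realType} {d : measure_display} {T : measurableType d}.
Variables (g1 g2 : {finite_measure set (T * T)%type -> \bar R}).
Variables (n : nat) (B : nat -> set T) (K : nat -> {nonneg R}).
Hypotheses (mB : forall i, measurable (B i)) (tB : trivIset setT B).
Hypothesis coverB : \big[setU/set0]_(i < n) B i = setT.
Hypothesis g1K : forall i, (g1 (setT `*` B i) <= (K i)%:num%:E)%E.
Hypothesis g2K : forall i, (g2 (B i `*` setT) <= (K i)%:num%:E)%E.

Let D i := (setT `*` B i) `*` (B i `*` setT) : set ((T * T) * (T * T)).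

Let mTB i : measurable (setT `*` B i : set (T * T)).
Proof. exact: measurableX. Qed.

Let mBT i : measurable (B i `*` setT : set (T * T)).
Proof. exact: measurableX. Qed.

Let mD i : measurable (D i).
Proof. exact: measurableX. Qed.

Let coverP x : exists2 i, (i < n)%N & B i x.
Proof.
by have : [set: T] x by []; rewrite -coverB -bigcup_mkord => -[i]; exists i.
Qed.

(** For a point [((x, y), (y', z))], [D i] says that [y] and [y'] both lie in [B i]. [K i] stands
    for the mass of [B i] under the intermediate distribution; as [0^-1 = 0], cells with [K i = 0]
    contribute nothing. *)
Definition glue : {measure set ((T * T) * (T * T))%type -> \bar R} :=
  msum (fun i => mscale ((K i)%:num^-1)%:nng (mrestr (g1 \x g2)%E (mD i))) n.

Lemma glueX A1 A2 : measurable A1 -> measurable A2 ->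
  glue (A1 `*` A2) = (\sum_(i < n) ((K i)%:num^-1)%:E *
    (g1 (A1 `&` (setT `*` B i)) * g2 (A2 `&` (B i `*` setT))))%E.
Proof.
move=> mA1 mA2; rewrite /glue /= /msum; apply: eq_bigr => i _.
rewrite /= /mscale /= /mrestr /D -setXI product_measure1E//; exact: measurableI.
Qed.

(** Each summand lives on its own [D i]. Hence almost surely the two middle points share a cell. *)
Lemma glue_off_partition : glue (~` (\bigcup_i D i)) = 0%E.
Proof.
rewrite /glue /= /msum big1// => i _; rewrite /= /mscale /= /mrestr.
rewrite (_ : _ `&` _ = set0) ?measure0 ?mule0//.
by apply/seteqP; split => // w [nw Dw]; apply: nw; exists i.
Qed.

Lemma cylinder_partition1 :
  trivIset setT (fun i => setT `*` B i : set (T * T)) /\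
  \big[setU/set0]_(i < n) (setT `*` B i : set (T * T)) = setT.
Proof.
split.
  apply/trivIsetP => i j _ _ ij; have /trivIsetP/(_ i j I I ij) := tB.
  move=> Bij; apply/seteqP; split => // -[x y] [[_ /= Bi] [_ /= Bj]].
  by have : (B i `&` B j) y by []; rewrite Bij.
apply/seteqP; split=> // -[x y] _.
rewrite -(bigcup_mkord n (fun i => setT `*` B i)).
have [i ? ?] := coverP y.
by exists i.
Qed.

Lemma cylinder_partition2 :
  trivIset setT (fun i => B i `*` setT : set (T * T)) /\
  \big[setU/set0]_(i < n) (B i `*` setT : set (T * T)) = setT.
Proof.
split.
  apply/trivIsetP => i j _ _ ij; have /trivIsetP/(_ i j I I ij) := tB.
  move=> Bij; apply/seteqP; split => // -[x y] [[/= Bi _] [/= Bj _]].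
  by have : (B i `&` B j) x by []; rewrite Bij.
apply/seteqP; split=> // -[x y] _.
rewrite -(bigcup_mkord n (fun i => B i `*` setT)).
have [i ? ?] := coverP x.
by exists i.
Qed.

Lemma invK_mul_le1 i (b : \bar R) : (b <= (K i)%:num%:E)%E ->
  (((K i)%:num^-1)%:E * b <= 1)%E.
Proof.
move=> bK; have [K0|K0] := eqVneq (K i)%:num 0.
  by rewrite K0 invr0 mul0e lee_fin ler01.
have {}K0 : 0 < (K i)%:num by rewrite lt_neqAle eq_sym K0/=.
by rewrite lee_pdivrMl// mule1.
Qed.

(** On the i-th cell, [g1] is multiplied by [K_i^-1 g2(B_i x T) <= 1]; the remaining [g1] terms add
    up to [g1 A]. *)
Lemma glue_fst A : measurable A -> (glue (A `*` setT) <= g1 A)%E.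
Proof.
move=> mA; have [t1 c1] := cylinder_partition1.
rewrite glueX// (measure_partition g1 mTB t1 c1 mA).
apply: lee_sum => i _; rewrite setTI muleCA -[leRHS]mule1.
by apply: lee_wpmul2l => //; exact: invK_mul_le1.
Qed.

Lemma glue_snd A : measurable A -> (glue (setT `*` A) <= g2 A)%E.
Proof.
move=> mA; have [t1 c1] := cylinder_partition2.
rewrite glueX// (measure_partition g2 mBT t1 c1 mA).
apply: lee_sum => i _; rewrite setTI muleA -[leRHS]mul1e.
by apply: lee_wpmul2r => //; exact: invK_mul_le1.
Qed.

(* [(K - a) * (K - b) >= 0] gives [a * b / K >= a + b - K]; at [K = 0], where
   [K^-1 = 0], also [a = b = 0]. *)
Lemma glue_mass :
  (g1 setT + g2 setT <= glue setT + \sum_(i < n) (K i)%:num%:E)%E.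
Proof.
have [t1 c1] := cylinder_partition1; have [t2 c2] := cylinder_partition2.
rewrite (measure_partition g1 mTB t1 c1 measurableT).
rewrite (measure_partition g2 mBT t2 c2 measurableT).
rewrite -[X in glue X]setXTT glueX// -!big_split/=.
apply: lee_sum => i _; rewrite !setTI.
have [a g1E a0] : exists2 a, g1 (setT `*` B i) = a%:E & 0 <= a.
  exists (fine (g1 (setT `*` B i))); last exact: fine_ge0.
  by rewrite fineK// fin_num_measure.
have [b g2E b0] : exists2 b, g2 (B i `*` setT) = b%:E & 0 <= b.
  exists (fine (g2 (B i `*` setT))); last exact: fine_ge0.
  by rewrite fineK// fin_num_measure.
move: (g1K i) (g2K i); rewrite g1E g2E !lee_fin; set k := (K i)%:num => aK bK.
suff : a + b <= k^-1 * (a * b) + k by rewrite -lee_fin !EFinD !EFinM.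
have [k0|k0] := eqVneq k 0; first by rewrite k0 invr0 mul0r addr0; rewrite k0 in aK bK; lra.
have {}k0 : 0 < k by rewrite lt_neqAle eq_sym k0 (le_trans a0 aK).
rewrite -(ler_pM2l k0) [leRHS]mulrDr mulVKf ?gt_eqF//; nra.
Qed.

End gluing.

(** * Triangle inequality for partial Wasserstein distances *)

Section triangle.
Context {R : realType} {d : measure_display} {T : measurableType d}.
Variables (c : T -> T -> R) (p : R).
Hypotheses (c_metric : is_metric c) (c_borel : is_borel c).
Hypotheses (c_cpt : c_compact c) (c_le1 : forall x y, c x y <= 1).
Hypothesis p1 : 1 <= p.
Implicit Types (g : {measure set (T * T)%type -> \bar R}).
Implicit Types (mu nu kappa : probability T R).

(** For [w = ((x, y), (y', z))], the last clause makes the jump from [y] to [y'] cost at most [r],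
    replacing the exact match [y = y'] of a disintegration. *)
Lemma glue_plans mu nu kappa (a b s : R) g1 g2 (r : R) : 0 < r ->
  partial_plan mu kappa a g1 -> partial_plan kappa nu b g2 ->
  0 <= s -> s <= a + b - 1 ->
  exists eta : {measure set ((T * T) * (T * T))%type -> \bar R},
  [/\ eta setT = s%:E,
      forall A, measurable A -> (eta (fst @^-1` A) <= g1 A)%E,
      forall A, measurable A -> (eta (snd @^-1` A) <= g2 A)%E &
      {ae eta, forall w, c w.1.2 w.2.1 <= r}].
Proof.
move=> r0 gp1 gp2 s0 sab.
(* The product measure in [glue] is built from measures carrying a finiteness structure. *)
have [m1 m1E] := finite_measure_of (plan_lty gp1).
have [m2 m2E] := finite_measure_of (plan_lty gp2).
rewrite {}m1E {}m2E {g1 g2} in gp1 gp2 *.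
have [m1T m11 m12] := gp1; have [m2T m21 m22] := gp2.
have [n [B [mB tB BT Br]]] := finite_c_partition c_metric c_borel c_cpt r0.
have K0 i : 0 <= fine (kappa (B i)) by exact: fine_ge0.
(* With [K i = kappa (B i)], the marginal conditions of the plans are the bounds required for
   gluing, and the [K i] sum to 1. *)
pose K i := NngNum (K0 i).
have KE i : (K i)%:num%:E = kappa (B i) by rewrite /= fineK// fin_num_measure.
have m1K i : (m1 (setT `*` B i) <= (K i)%:num%:E)%E by rewrite KE; exact: m12.
have m2K i : (m2 (B i `*` setT) <= (K i)%:num%:E)%E by rewrite KE; exact: m21.
pose eta0 := glue m1 m2 n K mB.
have sumK : (\sum_(i < n) (K i)%:num%:E = 1)%E.
  rewrite -(probability_setT kappa) (measure_partition kappa mB tB BT measurableT).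
  by apply: eq_bigr => i _; rewrite KE setTI.
have fst_le A : measurable A -> (eta0 (fst @^-1` A) <= m1 A)%E.
  move=> mA; rewrite [X in eta0 X](_ : _ = A `*` setT); last first.
    by apply/seteqP; split => [[x y] //|[x y] []].
  exact: glue_fst.
have snd_le A : measurable A -> (eta0 (snd @^-1` A) <= m2 A)%E.
  move=> mA; rewrite [X in eta0 X](_ : _ = setT `*` A); last first.
    by apply/seteqP; split => [[x y] //|[x y] []].
  exact: glue_snd.
have mass_ge : (s%:E <= eta0 setT)%E.
  have := glue_mass mB tB BT m1K m2K; rewrite sumK m1T m2T -EFinD => h.
  rewrite -(leeD2rE (x := 1%E))//; apply: le_trans h.
  by rewrite -EFinD lee_fin; lra.
have mass_fin : eta0 setT \is a fin_num.
  rewrite ge0_fin_numE//; have := fst_le setT measurableT; rewrite preimage_setT.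
  by move=> /le_lt_trans; apply; rewrite m1T ltry.
(* The glued mass is at least [a + b - 1 >= s]; scaling by this factor, at most 1, makes it exactly
   [s] and preserves domination. *)
have t0 : 0 <= s / fine (eta0 setT) by rewrite divr_ge0// fine_ge0.
have s_le : s <= fine (eta0 setT) by rewrite -lee_fin fineK.
have t1 : s / fine (eta0 setT) <= 1.
  have [z|z] := eqVneq (fine (eta0 setT)) 0; first by rewrite z invr0 mulr0.
  by rewrite ler_pdivrMr ?mul1r// lt_neqAle eq_sym z fine_ge0.
pose eta : {measure set ((T * T) * (T * T))%type -> \bar R} :=
  mscale (NngNum t0) eta0.
have eta_le A : measurable A -> (eta A <= eta0 A)%E.
  by move=> mA; rewrite -[leRHS]mul1e; apply: lee_wpmul2r => //; rewrite lee_fin.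
exists eta; split.
- rewrite /eta /= /mscale /= -{2}(fineK mass_fin) -EFinM.
  (* If the glued mass is 0, the factor [s / 0] is 0, and [s] is 0 as well. *)
  have [z|z] := eqVneq (fine (eta0 setT)) 0; last by rewrite mulfVK.
  by rewrite z mulr0; congr EFin; apply/eqP; rewrite eq_le s0 -z s_le.
- move=> A mA; apply: le_trans (fst_le _ mA); apply: eta_le.
  by rewrite -[X in measurable X]setTI; exact: measurable_fst.
- move=> A mA; apply: le_trans (snd_le _ mA); apply: eta_le.
  by rewrite -[X in measurable X]setTI; exact: measurable_snd.
exists (~` (\bigcup_i ((setT `*` B i) `*` (B i `*` setT)))); split.
- apply: measurableC; apply: bigcupT_measurable => i.
  by apply: measurableX; exact: measurableX.
- by rewrite /eta /= /mscale /= glue_off_partition mule0.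
move=> w /= nw [i _ [[_ /= B1] [B2 _]]]; apply: nw.
by rewrite ltW//; exact: Br B1 B2.
Qed.

(** The new plan is the law of the endpoints [(x, z)] under the glued measure. Minkowski's
    inequality splits its cost into the legs [c x y], [c y' z] and the jump [c y y']. *)
Lemma wcost_glue mu nu kappa (a b s : R) g1 g2 (r : R) : 0 < r ->
  partial_plan mu kappa a g1 -> partial_plan kappa nu b g2 ->
  0 <= s -> s <= 1 -> s <= a + b - 1 ->
  exists2 g, partial_plan mu nu s g &
    wcost c p g <= wcost c p g1 + wcost c p g2 + r.
Proof.
move=> r0 gp1 gp2 s0 s1 sab.
have [eta [etaT eta1 eta2 etar]] := glue_plans r0 gp1 gp2 s0 sab.
have p0 : 0 < p by exact: lt_le_trans p1.
have mc := measurable_c_pair c_metric c_borel c_cpt.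
have m11 : measurable_fun setT (fun w : (T * T) * (T * T) => w.1.1).
  exact: measurableT_comp measurable_fst measurable_fst.
have m12 : measurable_fun setT (fun w : (T * T) * (T * T) => w.1.2).
  exact: measurableT_comp measurable_snd measurable_fst.
have m21 : measurable_fun setT (fun w : (T * T) * (T * T) => w.2.1).
  exact: measurableT_comp measurable_fst measurable_snd.
have m22 : measurable_fun setT (fun w : (T * T) * (T * T) => w.2.2).
  exact: measurableT_comp measurable_snd measurable_snd.
have mphi := measurable_fun_pair m11 m22.
have mpsi := measurable_fun_pair m12 m21.
set phi := fun w : (T * T) * (T * T) => (w.1.1, w.2.2) in mphi.
set psi := fun w : (T * T) * (T * T) => (w.1.2, w.2.1) in mpsi.
pose cz (z : T * T) := c z.1 z.2.
have cz0 z : 0 <= cz z by exact: c_ge0.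
have gp : partial_plan mu nu s (push_measure eta mphi).
  rewrite /partial_plan /push_measure /= /pushforward; split.
  - by rewrite preimage_setT.
  - move=> A mA; case: gp1 => _ h _; apply: le_trans (h A mA).
    rewrite [X in eta X](_ : _ = fst @^-1` (A `*` setT)); last first.
      by apply/seteqP; split => w /= [].
    by apply: eta1; exact: measurableX.
  - move=> A mA; case: gp2 => _ _ h; apply: le_trans (h A mA).
    rewrite [X in eta X](_ : _ = snd @^-1` (setT `*` A)); last first.
      by apply/seteqP; split => w /= [].
    by apply: eta2; exact: measurableX.
exists (push_measure eta mphi) => //.
have wE := wcost_Lnorm c_metric c_borel c_cpt c_le1 p1.
rewrite -lee_fin !EFinD (wE _ (plan_lty gp)).
rewrite (wE _ (plan_lty gp1)) (wE _ (plan_lty gp2)).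
rewrite Lnorm_pushforward//.
have mfst : measurable_fun setT (cz \o (@fst (T * T) (T * T))).
  exact: measurableT_comp mc measurable_fst.
have msnd : measurable_fun setT (cz \o (@snd (T * T) (T * T))).
  exact: measurableT_comp mc measurable_snd.
have mcpsi : measurable_fun setT (cz \o psi) by exact: measurableT_comp mc mpsi.
apply: (@le_trans _ _ (Lnorm eta p%:E
    (EFin \o ((cz \o fst) \+ (cz \o snd) \+ (cz \o psi))))).
  apply: ae_le_Lnorm => //.
  - exact: ltW.
  - by move=> w; exact: cz0.
  - by move=> w /=; rewrite !addr_ge0.
  - exact: measurableT_comp mc mphi.
  - by apply: measurable_funD => //; exact: measurable_funD.
  apply: nearW => -[[x y] [y' z]]; rewrite /cz /phi /psi /=.
  have := c_triangle c_metric x y z; have := c_triangle c_metric y y' z; lra.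
apply: le_trans (minkowski_EFin _ _ _ _) _ => //; first exact: measurable_funD.
apply: leeD.
  apply: le_trans (minkowski_EFin _ _ _ _) _ => //.
  apply: leeD.
  - by apply: le_Lnorm_pushforward => //; exact: ltW.
  - by apply: le_Lnorm_pushforward => //; exact: ltW.
(* The jump is at most [r] almost everywhere, and the total mass [s] is at most 1. *)
apply: (@le_trans _ _ (Lnorm eta p%:E (EFin \o cst r))).
  apply: ae_le_Lnorm => //; first exact: ltW.
    by move=> w /=; exact: cz0.
  by move=> w; exact: ltW.
apply: Lnorm_cst_le => //; first exact: ltW.
by rewrite etaT lee_fin.
Qed.

Lemma Wpa_triangle mu nu kappa (a b s u v : R) :
  0 <= s -> s <= 1 -> s <= a + b - 1 ->
  (Wpa c p a mu kappa <= u%:E)%E -> (Wpa c p b kappa nu <= v%:E)%E ->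
  (Wpa c p s mu nu <= (u + v)%:E)%E.
Proof.
move=> s0 s1 sab hu hv; apply/lee_addgt0Pr => e e0.
(* One third for each near-optimal plan, one third for the gluing error. *)
have e30 : 0 < e / 3 by rewrite divr_gt0.
have /ereal_inf_lt[_ [g1 gp1 <-] g1u] : (Wpa c p a mu kappa < (u + e / 3)%:E)%E.
  by apply: le_lt_trans hu _; rewrite lte_fin ltrDl.
have /ereal_inf_lt[_ [g2 gp2 <-] g2v] : (Wpa c p b kappa nu < (v + e / 3)%:E)%E.
  by apply: le_lt_trans hv _; rewrite lte_fin ltrDl.
have [g gp gle] := wcost_glue e30 gp1 gp2 s0 s1 sab.
apply: ge_ereal_inf; exists (wcost c p g)%:E; first by exists g.
rewrite !lte_fin in g1u g2v; rewrite -EFinD lee_fin; lra.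
Qed.

End triangle.

(** * Metric axioms for the RPW distance *)

Section RPW_metric.
Context {R : realType} {d : measure_display} {T : measurableType d}.
Variables (c : T -> T -> R) (p k : R).
Hypotheses (c_metric : is_metric c) (c_borel : is_borel c).
Hypotheses (c_cpt : c_compact c) (c_le1 : forall x y, c x y <= 1).
Hypotheses (p1 : 1 <= p) (k0 : 0 <= k).
Implicit Types (mu nu kappa : probability T R).

Lemma RPW_ge0 mu nu : (0 <= RPW c p k mu nu)%E.
Proof. by apply: le_ereal_inf_tmp => _ [e [/andP[e0 _] _] <-]; rewrite lee_fin. Qed.

Lemma RPW_le (mu nu : set T -> \bar R) (e : R) : 0 <= e <= 1 ->
  (Wpa c p (1 - e) mu nu <= (k * e)%:E)%E -> (RPW c p k mu nu <= e%:E)%E.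
Proof. by move=> e01 We; apply: ge_ereal_inf; exists e%:E => //; exists e. Qed.

(** The value [e = 1] is always admissible: the zero measure is a plan of mass 0 and cost 0. *)
Lemma RPW_le1 mu nu : (RPW c p k mu nu <= 1)%E.
Proof.
apply: RPW_le; rewrite ?ler01 ?lexx// subrr mulr1.
apply: ge_ereal_inf; exists 0%E; rewrite ?lee_fin//; exists mzero.
  by split=> [//|A _|A _]; rewrite /= /mzero measure_ge0.
rewrite /wcost integral_measure_zero powR0// invr_eq0 gt_eqF//.
exact: lt_le_trans p1.
Qed.

Lemma RPW_refl mu : RPW c p k mu mu = 0%E.
Proof.
apply/eqP; rewrite eq_le RPW_ge0 andbT; apply: RPW_le; rewrite ?lexx ?ler01//.
rewrite subr0 mulr0; apply: ge_ereal_inf; exists 0%E => //.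
have := diagonal_plan mu; set g := push_measure _ _ => gp; exists g => //.
by rewrite wcost_diagonal.
Qed.

Lemma RPW_sym mu nu : RPW c p k mu nu = RPW c p k nu mu.
Proof.
rewrite /RPW; congr (ereal_inf (image _ _)); apply/funext => e /=.
by rewrite (Wpa_sym c_metric c_borel c_cpt c_le1 p1).
Qed.

Lemma RPW_triangle mu nu kappa :
  (RPW c p k mu nu <= RPW c p k mu kappa + RPW c p k kappa nu)%E.
Proof.
have RPW_fin (m m' : probability T R) : RPW c p k m m' \is a fin_num.
  by rewrite (ge0_fin_numE (RPW_ge0 m m')) (le_lt_trans (RPW_le1 m m') (ltry 1)).
apply/lee_addgt0Pr => e e0; have e20 : 0 < e / 2 by rewrite divr_gt0.
have [_ [e1 [/andP[e10 e11] W1] <-] l1] :=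
  lb_ereal_inf_adherent e20 (RPW_fin mu kappa).
have [_ [e2 [/andP[e21 e22] W2] <-] l2] :=
  lb_ereal_inf_adherent e20 (RPW_fin kappa nu).
apply: (@le_trans _ _ (e1 + e2)%:E); last first.
  move: l1 l2; rewrite -/(RPW c p k mu kappa) -/(RPW c p k kappa nu).
  rewrite -(fineK (RPW_fin mu kappa)) -(fineK (RPW_fin kappa nu)).
  rewrite -!EFinD !lte_fin lee_fin; lra.
(* If [e1 + e2 <= 1], it is admissible: gluing yields mass [(1 - e1) + (1 - e2) - 1 = 1 - (e1 + e2)]
   at cost up to [k e1 + k e2]. Otherwise the bound by 1 suffices. *)
have [le1|gt1] := leP (e1 + e2) 1; last first.
  by apply: le_trans (RPW_le1 mu nu) _; rewrite lee_fin ltW.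
apply: RPW_le; first by rewrite addr_ge0.
rewrite mulrDr.
by apply: (Wpa_triangle c_metric c_borel c_cpt c_le1 p1 _ _ _ W1 W2); lra.
Qed.

Lemma RPW0_le_thickening mu nu (A B : set T) (r : R) : 0 < r ->
  (RPW c p k mu nu <= 0)%E -> measurable A -> measurable B ->
  (forall x y, A x -> ~ B y -> r <= c x y) -> (mu A <= nu B)%E.
Proof.
move=> r0 RPW0 mA mB AB; apply/lee_addgt0Pr => e e0.
(* An admissible [e1 < t] has a plan of cost below [k t + t], the extra [t] being the slack above
   the infimum. The total error is then at most [t + (k t + t) / r = t q], which is [e] for
   [t = e / q]. *)
pose q := 1 + (k + 1) / r.
have q0 : 0 < q by rewrite /q ltr_wpDr// divr_ge0 ?addr_ge0// ltW.
have [t t0 eE] : exists2 t, 0 < t & e = t + (k * t + t) / r.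
  exists (e / q); first by rewrite divr_gt0.
  rewrite -[LHS](divfK (lt0r_neq0 q0)); set t := e / q.
  by rewrite /q mulrDr mulr1 mulrA mulrDr mulr1 (mulrC t k).
have /ereal_inf_lt[_ [e1 [e01 W1] <-]] : (RPW c p k mu nu < t%:E)%E.
  by apply: le_lt_trans RPW0 _; rewrite lte_fin.
rewrite lte_fin => e1t.
have /ereal_inf_lt[_ [g gp <-]] :
    (Wpa c p (1 - e1) mu nu < (k * t + t)%:E)%E.
  apply: le_lt_trans W1 _; rewrite lte_fin.
  by have := ler_wpM2l k0 (ltW e1t); lra.
rewrite lte_fin => wlt.
have sep := plan_separated_sets c_metric c_borel c_cpt c_le1 p1 r0 e01 gp.
apply: le_trans (sep A B mA mB AB) _.
apply: leeD2l; rewrite lee_fin eE lerD ?ltW//.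
by rewrite ltr_pM2r ?invr_gt0.
Qed.

(** The open thickenings [F n] of a closed set decrease to it, so continuity of [nu] from above
    passes the thickened bound to the limit. *)
Lemma RPW0_le_closed mu nu (A : set T) : (RPW c p k mu nu <= 0)%E ->
  c_open c (~` A) -> (mu A <= nu A)%E.
Proof.
move=> RPW0 oA.
pose F n := \bigcup_(x in A) [set y | c x y < n.+1%:R^-1].
have mF n : measurable (F n).
  apply: (c_open_measurable c_borel); apply: c_open_bigcup => x _.
  exact: c_open_ball.
have mA : measurable A.
  by rewrite -[A]setCK; apply/measurableC/(c_open_measurable c_borel).
have FA : \bigcap_n F n = A.
  apply/seteqP; split => [y Fy|y Ay n _]; last by exists y => //=; rewrite c_refl.
  apply: contrapT => nAy; have [r r0 rA] := oA y nAy.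
  have [n /= nr] := ltr_add_invr r0; rewrite add0r in nr.
  have [x Ax /= xy] := Fy n I.
  by apply: (rA x) => //=; rewrite (c_sym c_metric) (lt_trans xy).
have ndF : nonincreasing_seq F.
  move=> m n mn; apply/subsetPset => y [x Ax /= xy]; exists x => //=.
  by apply: lt_le_trans xy _; rewrite lef_pV2 ?posrE// ler_nat.
have cvF : nu \o F @ \oo --> nu A.
  rewrite -FA; apply: nonincreasing_cvg_mu => //; last by rewrite FA.
  by rewrite -ge0_fin_numE// fin_num_measure.
rewrite -(cvg_lim _ cvF)//; apply: lime_ge; first by apply/cvg_ex; exists (nu A).
apply: nearW => n; apply: (@RPW0_le_thickening _ _ _ _ n.+1%:R^-1) => //.
by move=> x y Ax nFy; rewrite leNgt; apply/negP => xy; apply: nFy; exists x.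
Qed.

Lemma RPW0_eq mu nu (A : set T) : (RPW c p k mu nu <= 0)%E ->
  measurable A -> mu A = nu A.
Proof.
move=> RPW0 /c_borel mA.
(* The open sets form an intersection-stable generator, so agreement on them suffices. It follows
   from the inequalities between [mu] and [nu], in both directions, on the closed complement. *)
apply: (g_sigma_algebra_measure_unique (c_open c) _ (fun=> setT)) mA => //.
- by move=> B oB; exact: (c_open_measurable c_borel).
- by move=> _ x _; exists 1.
- by apply/seteqP; split => // x _; exists 0%N.
- exact: c_openI.
- move=> B oB; have mB := c_open_measurable c_borel oB.
  have oCB : c_open c (~` ~` B) by rewrite setCK.
  have := RPW0_le_closed RPW0 oCB.
  have RPW0' : (RPW c p k nu mu <= 0)%E by rewrite RPW_sym.
  have := RPW0_le_closed RPW0' oCB.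
  have [a aE] : exists a, mu B = a%:E.
    by exists (fine (mu B)); rewrite fineK// fin_num_measure.
  have [b bE] : exists b, nu B = b%:E.
    by exists (fine (nu B)); rewrite fineK// fin_num_measure.
  rewrite !probability_setC// aE bE -!EFinB !lee_fin => ab ba.
  by suff: mu B = nu B by []; rewrite aE bE; congr EFin; lra.
- by move=> _; suff: (mu setT < +oo)%E by []; rewrite probability_setT ltry.
Qed.

End RPW_metric.

Unset Implicit Arguments.

Theorem theorem2p1 (R : realType) (d : measure_display) (T : measurableType d)
  (c : T -> T -> R)
  (hmetric : is_metric c) (hdiam : forall x y, c x y <= 1)
  (hborel : is_borel c) (hcompact : c_compact c)
  (p k : R) (hp : 1 <= p) (hk : 0 <= k) :
  forall mu nu kappa : probability T R,
  [/\ RPW c p k mu mu = 0%E,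
      (exists2 A, measurable A & mu A <> nu A) -> (0 < RPW c p k mu nu)%E,
      RPW c p k mu nu = RPW c p k nu mu &
      (RPW c p k mu nu <= RPW c p k mu kappa + RPW c p k kappa nu)%E].
Proof.
move=> mu nu kappa; split.
- exact: RPW_refl.
- move=> [A mA muA]; rewrite ltNge; apply/negP => RPW0; apply: muA.
  exact: (RPW0_eq hmetric hborel hcompact hdiam hp hk RPW0).
- exact: RPW_sym.
- exact: RPW_triangle.
Qed.
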